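(* Let $(\mathcal X,\mathcal A,p_x,p_a,q)$ be a first-exit state-action LMDP with terminal set $\mathcal T\subset\mathcal X\times\mathcal A$, let $v^*$ satisfy its first-exit Bellman equation: $v^*=q$ on $\mathcal T$, and for $(x,a)\notin\mathcal T$ $$v^*(x,a)=\min_{u_a}\Big[q(x,a)+\mathbb E_{x'\sim p_x(\cdot|x,a),\,a'\sim u_a(\cdot|x';x,a)}\Big[\log\frac{u_a(a'|x';x,a)}{p_a(a'|x';x,a)}+v^*(x',a')\Big]\Big],$$ and put $z^*(x,a)=\exp(-v^*(x,a))$ and $\mathfrak N[z](x',x,a)=\sum_{a'}p_a(a'|x';x,a)\,z(x',a')$. Then: (1) The minimum is attained by the policy $$u_a^*(a'|x';x,a)=\frac{p_a(a'|x';x,a)\,z^*(x',a')}{\mathfrak N[z^*](x',x,a)}$$ (for all $x'$ with $p_x(x'|x,a)>0$ and $\mathfrak N[z^*](x',x,a)>0$). (2) For all $(x,a)\notin\mathcal T$, $$z^*(x,a)=\exp(-q(x,a))\,\exp\Big(\mathbb E_{x'\sim p_x(\cdot|x,a)}\log \mathfrak N[z^*](x',x,a)\Big).$$ (3) If $p_x$ is deterministic, then for all $(x,a)\notin\mathcal T$, $$z^*(x,a)=\exp(-q(x,a))\,\mathbb E_{x'\sim p_x(\cdot|x,a)}\,\mathfrak N[z^*](x',x,a).$$ Consequently, when the terminal state-actions have zero cost, the vector $\mathbf z$ of values of $z^*$ on $\mathcal X\times\mathcal A$ satisfies $\mathbf z=QP_{xa}\mathbf z$, i.e. it is a principal eigenvector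 of $QP_{xa}$ with eigenvalue $1$, where $Q=\mathrm{diag}(\exp(-\mathbf q))$ and $P_{xa}$ is the matrix of the joint passive dynamics.
   Context: A state-action LMDP (saLMDP) is a tuple $(\mathcal X,\mathcal A,p_x,p_a,q)$ where $\mathcal X,\mathcal A$ are finite sets (states, actions), $p_x(x'|x,a)$ is a state-transition kernel, $p_a(a'|x';x,a)$ is a ''passive'' action-transition kernel (for each $(x',x,a)$ a probability distribution on $a'\in\mathcal A$), and $q:\mathcal X\times\mathcal A\to[0,\infty]$ is a cost function, with a constant cost $c\in(0,\infty)$ at state-actions that are neither goals (terminal) nor obstacles, cost $+\infty$ at obstacles, and finite cost at the terminal (goal) state-actions. The state transition kernel $p_x$ is fixed and not controllable; only the action kernel $u_a(a'|x';x,a)$ is optimized, over all families of probability distributions on $\mathcal A$. Deterministic $p_x$ means that for each $(x,a)$ there is exactly one $x'$ with $p_x(x'|x,a)=1$. The joint passive dynamics is $p_{xa}(x',a'|x,a)=p_x(x'|x,a)\,p_a(a'|x';x,a)$. In the first-exit problem the process stops on first hitting $\mathcal T$; accordingly, in the matrix $P_{xa}$ (indexed by $\mathcal X\times\mathcal A$) the rows of non-terminal state-actions are given by $p_{xa}$ and the rows of terminal state-actions are those of the identity (absorbing). Conventions: $\exp(-\infty)=0$, $\log 0=-\infty$, $v^*$ takes values in $[-\infty,+\infty]$ with $v^*>-\infty$, $0\cdot\log(0/\cdot)=0$, and $\log(u/0)=+\infty$ for $u>0$ (so policies not absolutely continuous with respect to $p_a$ have infinite cost). *)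

(* Defs.v *)
From mathcomp Require Import all_boot all_order all_algebra.
From mathcomp Require Import classical_sets reals ereal exp.
From mathcomp Require Import complex.

Set Implicit Arguments.
Unset Strict Implicit.
Unset Printing Implicit Defensive.

Import Order.TTheory GRing.Theory Num.Theory.

Local Open Scope classical_set_scope.
Local Open Scope ring_scope.

Definition is_distr (R : realType) (S : finType) (p : S -> R) : Prop :=
  (forall s, 0 <= p s) /\ \sum_s p s = 1.

(* Since [0 * +oo = 0 * -oo = 0] in [\bar R], points outside the support of [p]
   contribute nothing, whatever the value of [f] there. *)
Definition expect (R : realType) (S : finType) (p : S -> R) (f : S -> \bar R)
    : \bar R :=
  (\sum_s (p s)%:E * f s)%E.

(* Conditioning arguments come first and the outcome last:
   [px x a x'] is p_x(x'|x,a) and [pa x' x a a'] is p_a(a'|x';x,a). *)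
Record saLMDP (R : realType) (X A : finType) := SaLMDP {
  px : X -> A -> X -> R;
  pa : X -> X -> A -> A -> R;
  q : X -> A -> \bar R;
  terminal : {set X * A};
  obstacle : {set X * A};
  step_cost : R;
  px_distr : forall x a, is_distr (px x a);
  pa_distr : forall x' x a, is_distr (pa x' x a);
  step_cost_gt0 : 0 < step_cost;
  q_step : forall x a, (x, a) \notin terminal -> (x, a) \notin obstacle ->
    q x a = step_cost%:E;
  q_obstacle : forall x a, (x, a) \in obstacle -> q x a = +oo%E;
  q_terminal : forall x a, (x, a) \in terminal -> (0 <= q x a < +oo)%E
}.

Section Definitions.
Context {R : realType} {X A : finType}.
Variable M : saLMDP R X A.

(* A policy [u] has the shape of [pa]: [u x' x a a'] is u_a(a'|x';x,a). *)
Definition is_policy (u : X -> X -> A -> A -> R) : Prop :=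
  forall x' x a, is_distr (u x' x a).

(* The law of (x',a') given (x,a); [joint pa] is p_xa. *)
Definition joint (u : X -> X -> A -> A -> R) (x : X) (a : A) (s : X * A) : R :=
  px M x a s.1 * u s.1 x a s.2.

(* log (u / p). In [\bar R], [0^-1 = +oo], hence this is [+oo] when
   [u > 0] and [p = 0]; it is [-oo] when [u = 0]. *)
Definition log_ratio (u p : R) : \bar R := lne (u%:E / p%:E)%E.

Definition bellman_cost (v : X -> A -> \bar R) (u : X -> X -> A -> A -> R)
    (x : X) (a : A) : \bar R :=
  (q M x a + expect (joint u x a) (fun s =>
     log_ratio (u s.1 x a s.2) (pa M s.1 x a s.2) + v s.1 s.2))%E.

(* The minimum is read as an infimum, so that its being attained is not part of
   the equation. *)
Definition first_exit_bellman (v : X -> A -> \bar R) : Prop :=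
  [/\ forall x a, (-oo < v x a)%E,
      forall x a, (x, a) \in terminal M -> v x a = q M x a
    & forall x a, (x, a) \notin terminal M ->
        v x a = ereal_inf [set bellman_cost v u x a | u in is_policy]].

(* exp (- v) as a real number; meaningful for [v > -oo]. *)
Definition exp_opp (v : \bar R) : R := fine (expeR (- v)%E).

Definition desirability (v : X -> A -> \bar R) (x : X) (a : A) : R :=
  exp_opp (v x a).

Definition normalizer (z : X -> A -> R) (x' x : X) (a : A) : R :=
  \sum_(a' : A) pa M x' x a a' * z x' a'.

(* [u] is given by the formula for u_a* wherever that formula is meaningful. *)
Definition is_optimal_form (z : X -> A -> R) (u : X -> X -> A -> A -> R)
    (x : X) (a : A) : Prop :=
  forall x', 0 < px M x a x' -> 0 < normalizer z x' x a ->
    forall a', u x' x a a' = pa M x' x a a' * z x' a' / normalizer z x' x a.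

Definition attains_min (v : X -> A -> \bar R) (u : X -> X -> A -> A -> R)
    (x : X) (a : A) : Prop :=
  v x a = bellman_cost v u x a /\
  forall w, is_policy w -> (bellman_cost v u x a <= bellman_cost v w x a)%E.

Definition deterministic : Prop :=
  forall x a, exists! x', px M x a x' = 1.

(* Vectors and matrices over X * A are indexed through the enumeration
   [enum_val : 'I_#|X * A| -> X * A]. *)
Definition vec_of (f : X -> A -> R) : 'cV[R]_#|{: X * A}| :=
  \col_i f (enum_val i).1 (enum_val i).2.

Definition Qmx : 'M[R]_#|{: X * A}| :=
  diag_mx (\row_i exp_opp (q M (enum_val i).1 (enum_val i).2)).

Definition Pmx : 'M[R]_#|{: X * A}| :=
  \matrix_(i, j)
    if enum_val i \in terminal M then (i == j)%:R
    else joint (pa M) (enum_val i).1 (enum_val i).2 (enum_val j).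

End Definitions.

(* A (column) eigenvector whose eigenvalue has the largest modulus among all
   complex eigenvalues. [eigenvalue] is defined through row vectors; a square
   matrix and its transpose have the same eigenvalues. *)
Definition principal_eigenvector (R : realType) (n : nat) (B : 'M[R]_n)
    (lambda : R) (w : 'cV[R]_n) : Prop :=
  [/\ w != 0, B *m w = lambda *: w
    & forall mu : R[i], eigenvalue (map_mx (real_complex R) B) mu ->
        `|mu| <= (real_complex R) `|lambda|].

(* Main.v *)
(** Fix [x, a] and, for each [x'], put N(x') = sum over a' of p_a(a') z(x',a').
    The Bellman cost splits as q + E_x' [sum over a' of u log (u / p_a) + u v].
    Since v = - log z, the inner sum is - log N(x') plus the divergence of u
    from the distribution p_a z / N(x'), so by Gibbs' inequality its minimum is
    - log N(x'), attained at that distribution; when N(x') = 0 every policy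
    costs +oo.  Exponentiating v = q - E log N gives the formula for z.  For
    deterministic p_x the outer expectation is an evaluation, so exp and log
    cancel and the equation becomes linear.  The eigenvalue 1 is principal
    because q >= 0 makes Q P_xa substochastic. *)

Require Import Defs.
From mathcomp Require Import all_boot all_order all_algebra.
From mathcomp Require Import boolp classical_sets reals ereal sequences exp.
From mathcomp Require Import complex ring lra.

Set Implicit Arguments.
Unset Strict Implicit.
Unset Printing Implicit Defensive.

Import Order.TTheory GRing.Theory Num.Theory.

Local Open Scope ring_scope.

(** * Gibbs' inequality in the extended reals *)

Section ExtendedReals.
Context {R : realType}.
Implicit Types (x : \bar R) (u p N : R) (v : \bar R).

Lemma exp_oppE v : (-oo < v)%E -> (exp_opp v)%:E = expeR (- v)%E.
Proof. by case: v => [r||]. Qed.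

Lemma exp_opp_ge0 v : 0 <= exp_opp v.
Proof. exact/fine_ge0/expeR_ge0. Qed.

Lemma exp_opp_le1 v : (0 <= v)%E -> exp_opp v <= 1.
Proof.
case: v => [r v0|_|//]; last exact: ler01.
by rewrite /exp_opp /= -expR0 ler_expR oppr_le0 -lee_fin.
Qed.

Lemma mule_EFin_y u : 0 < u -> (u%:E * +oo = +oo)%E.
Proof. by move=> u0; apply: gt0_muley; rewrite lte_fin. Qed.

Lemma log_ratioE u p : 0 < u -> 0 < p -> log_ratio u p = (ln (u / p))%:E.
Proof.
by move=> u0 p0; rewrite /log_ratio inver gt_eqF// -EFinM lne_EFin// divr_gt0.
Qed.

Lemma log_ratio0 u : 0 < u -> log_ratio u 0 = +oo%E.
Proof. by move=> u0; rewrite /log_ratio inve0 mule_EFin_y. Qed.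

Lemma log_ratio_gtNy {u p} : 0 < u -> 0 <= p -> (-oo < log_ratio u p)%E.
Proof.
move=> u0; rewrite le_eqVlt => /predU1P[<-|p0]; first by rewrite log_ratio0.
by rewrite log_ratioE// ltNyr.
Qed.

Lemma mule_EFin_gtNy u x : 0 <= u -> (-oo < x)%E -> (-oo < u%:E * x)%E.
Proof.
rewrite le_eqVlt => /predU1P[<-|u0]; first by rewrite mul0e.
by case: x => [r _|_|//]; [rewrite -EFinM ltNyr | rewrite mule_EFin_y].
Qed.

(** Where [u = 0] the bracket is [-oo], but the factor 0 cancels it. Sums of such terms therefore
    never mix [-oo] with [+oo]. *)
Lemma divergence_term_gtNy u p v : 0 <= u -> 0 <= p -> (-oo < v)%E ->
  (-oo < u%:E * (log_ratio u p + v))%E.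
Proof.
rewrite le_eqVlt => /predU1P[<-|u0 p0 hv]; first by rewrite mul0e.
apply: mule_EFin_gtNy; first exact: ltW.
by rewrite ltNye adde_eq_ninfty negb_or -!ltNye log_ratio_gtNy.
Qed.

(* Gibbs' inequality termwise, from [ln t <= t - 1] with
   [t = p e^{-v} / (N u)]; the linear terms cancel upon summation. *)
Lemma divergence_term_ge u p N v : 0 <= u -> 0 <= p -> 0 < N -> (-oo < v)%E ->
  ((- (u * ln N) + (u - p * exp_opp v / N))%:E <=
   u%:E * (log_ratio u p + v))%E.
Proof.
rewrite le_eqVlt => /predU1P[<- p0 N0 _|u0].
  rewrite mul0e mul0r oppr0 !add0r lee_fin oppr_le0.
  by rewrite divr_ge0 ?mulr_ge0 ?exp_opp_ge0 ?(ltW N0).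
rewrite le_eqVlt => /predU1P[<-|p0] N0.
  by move=> hv; rewrite log_ratio0// addye -?ltNye// mule_EFin_y ?leey.
case: v => [r _|_|//]; last by rewrite addey ?log_ratioE// mule_EFin_y ?leey.
rewrite log_ratioE// -EFinD -EFinM lee_fin /exp_opp /=.
set t := p * expR (- r) / (N * u).
have t0 : 0 < t by rewrite divr_gt0 ?mulr_gt0 ?expR_gt0.
have lnt : ln t = ln p - r - ln N - ln u.
  by rewrite ln_div ?posrE ?mulr_gt0 ?expR_gt0//
     !lnM ?posrE ?expR_gt0// expRK opprD addrA.
have pE : p * expR (- r) / N = u * t.
  by rewrite /t; field; rewrite !gt_eqF.
have : ln t <= t - 1.
  have := @le_ln1Dx _ (t - 1); have -> : 1 + (t - 1) = t by ring.
  by apply; lra.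
rewrite lnt [ln (u / p)]ln_div// pE -(ler_pM2l u0 (_ - _ - _ - _)) => lnt_le.
lra.
Qed.

(** Equality case of Gibbs' inequality: for [u > 0] the logarithm is [- v - ln N], so [v] cancels.
    If [p = 0] or [v = +oo], then [u = 0] and both sides vanish. *)
Lemma divergence_term_eq u p N v : 0 <= p -> 0 < N -> (-oo < v)%E ->
  u = p * exp_opp v / N ->
  (u%:E * (log_ratio u p + v))%E = (- (u * ln N))%:E.
Proof.
rewrite le_eqVlt => /predU1P[<- _ _ ->|p0 N0].
  by rewrite !mul0r mul0e oppr0.
case: v => [r _|_|//]; rewrite /exp_opp /= => ->; last first.
  by rewrite mulr0 !mul0r mul0e oppr0.
have e0 := expR_gt0 (- r).
rewrite log_ratioE ?divr_gt0 ?mulr_gt0// -EFinD -EFinM; congr EFin.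
rewrite -mulrN; congr (_ * _).
have -> : p * expR (- r) / N / p = expR (- r) / N by field; rewrite !gt_eqF.
by rewrite ln_div ?posrE// expRK addrC addrA subrr add0r.
Qed.

(** Lower half of the Gibbs (Donsker-Varadhan) variational formula for the free energy [- log E_r
    [exp (- v)]]. *)
Lemma divergence_ge (S : finType) (w r : S -> R) (v : S -> \bar R) :
  is_distr w -> is_distr r -> (forall s, -oo < v s)%E ->
  (- lne (\sum_s r s * exp_opp (v s))%:E <=
   \sum_s (w s)%:E * (log_ratio (w s) (r s) + v s))%E.
Proof.
move=> [w0 w1] [r0 r1] hv; set N := \sum_s _.
have N0 : 0 <= N by apply: sumr_ge0 => s _; rewrite mulr_ge0 ?exp_opp_ge0.
move: N0; rewrite le_eqVlt => /predU1P[N0|N0]; last first.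
  rewrite lne_EFin// -EFinN.
  (* The constant is spread over [s] using that [w] has mass 1; the corrections
     [w s - r s * exp (- v s) / N] sum to 1 - 1 = 0. *)
  have -> : - ln N = \sum_s (- (w s * ln N) + (w s - r s * exp_opp (v s) / N)).
    rewrite big_split sumrB /= sumrN -!mulr_suml w1 -/N divff ?gt_eqF//.
    by rewrite subrr addr0 mul1r.
  rewrite -sumEFin; apply: lee_sum => s _; exact: divergence_term_ge.
(* Degenerate case [N = 0]: the left side is [+oo], so some term on the right must be [+oo]. Any [s]
   with [w s > 0] works, since there [r s = 0] or [v s = +oo]. *)
rewrite -N0 le0_lneNy//= leye_eq; apply/eqP.
have z0 s : r s * exp_opp (v s) = 0.
  move/eqP: (esym N0); rewrite psumr_eq0; last first.
    by move=> i _; rewrite mulr_ge0 ?exp_opp_ge0.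
  by move/allP/(_ s (mem_index_enum s))/eqP.
have [s ws] : exists s, 0 < w s.
  apply: contrapT => /forallNP wle0; move/eqP: w1; rewrite big1 ?(eq_sym 0) ?oner_eq0//.
  by move=> s _; apply/eqP; rewrite eq_le w0 andbT leNgt; apply/negP.
apply/esum_eqyP => [i _|]; first by rewrite -ltNye divergence_term_gtNy.
exists s; split; rewrite ?mem_index_enum//.
move/eqP: (z0 s); rewrite mulf_eq0 => /orP[/eqP->|/eqP vs].
  by rewrite log_ratio0// addye -?ltNye// mule_EFin_y.
have -> : v s = +oo%E.
  by have := hv s; case: (v s) vs => // t /eqP; rewrite /exp_opp /= gt_eqF ?expR_gt0.
by rewrite addey ?mule_EFin_y// -ltNye log_ratio_gtNy.
Qed.

Lemma divergence_eq (S : finType) (w r : S -> R) (v : S -> \bar R) :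
  let N := \sum_s r s * exp_opp (v s) in
  is_distr w -> is_distr r -> (forall s, -oo < v s)%E ->
  (0 < N -> forall s, w s = r s * exp_opp (v s) / N) ->
  (\sum_s (w s)%:E * (log_ratio (w s) (r s) + v s) = - lne N%:E)%E.
Proof.
move=> N wP rP hv wE; have [w0 w1] := wP; have [r0 r1] := rP.
(* When [N] is not positive nothing is prescribed for [w], but the lower bound is already [+oo]. *)
have [N0|N0] := ltP 0 N; last first.
  apply/eqP; rewrite eq_le divergence_ge// andbT.
  by rewrite [lne _]le0_lneNy ?lee_fin//= leey.
rewrite lne_EFin// -EFinN (eq_bigr (fun s => (- (w s * ln N))%:E)).
  by rewrite sumEFin sumrN -mulr_suml w1 mul1r.
by move=> s _; apply: divergence_term_eq => //; exact: wE.
Qed.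

End ExtendedReals.

(** * Expectations under a point mass *)

Section PointMass.
Context {R : realType} {S : finType} (p : S -> R) (y : S).
Hypotheses (p_distr : is_distr p) (py : p y = 1).

Lemma distr_eq0 s : s != y -> p s = 0.
Proof.
have [p0 p1] := p_distr; move=> sy; move: p1; rewrite (bigD1 y)//= py => /eqP.
rewrite -subr_eq0 addrAC subrr add0r psumr_eq0// => /allP/(_ s (mem_index_enum _)).
by rewrite sy => /eqP.
Qed.

Lemma expect_eq1 (f : S -> \bar R) : expect p f = f y.
Proof.
rewrite /expect (bigD1 y)//= py mul1e big1 ?adde0// => s /distr_eq0->.
by rewrite mul0e.
Qed.

Lemma sum_eq1 (f : S -> R) : \sum_s p s * f s = f y.
Proof.
rewrite (bigD1 y)//= py mul1r big1 ?addr0// => s /distr_eq0->.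
by rewrite mul0r.
Qed.

End PointMass.

(** For a left eigenvector [w], summing [|(w B)_j|] over [j] and exchanging sums bounds [|mu|] times
    the l1 norm of [w] by the row sums of [B] weighted with [|w_i|]. *)
Lemma substochastic_eigenvalue_norm (F : numFieldType) (n : nat) (B : 'M[F]_n)
    (mu : F) :
  (forall i j, 0 <= B i j) -> (forall i, \sum_j B i j <= 1) ->
  eigenvalue B mu -> `|mu| <= 1.
Proof.
move=> B0 B1 /eigenvalueP[w wB w0].
have W0 : 0 < \sum_j `|w 0 j|.
  rewrite lt_def sumr_ge0// andbT psumr_neq0//.
  by case/rV0Pn : w0 => j wj; apply/hasP; exists j; rewrite ?mem_index_enum//= normr_gt0.
rewrite -(ler_pM2r W0) mul1r mulr_sumr.
apply: (@le_trans _ _ (\sum_j \sum_i `|w 0 i| * B i j)).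
  apply: ler_sum => j _; rewrite -normrM.
  have <- : (w *m B) 0 j = mu * w 0 j by rewrite wB mxE.
  rewrite mxE (le_trans (ler_norm_sum _ _ _))//; apply: ler_sum => i _.
  by rewrite normrM (ger0_norm (B0 _ _)).
rewrite exchange_big /=; apply: ler_sum => i _.
by rewrite -mulr_sumr ler_piMr.
Qed.

(** * Bellman cost, optimal policy and passive matrix *)

Section LMDP.
Context {R : realType} {X A : finType} (M : saLMDP R X A).
Variable v : X -> A -> \bar R.
Hypothesis v_gtNy : forall x a, (-oo < v x a)%E.
Implicit Types (u : X -> X -> A -> A -> R) (x : X) (a : A).
Let z := desirability v.

Lemma desirability_ge0 x a : 0 <= z x a.
Proof. exact: exp_opp_ge0. Qed.

Lemma normalizer_ge0 x' x a : 0 <= normalizer M z x' x a.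
Proof.
by apply: sumr_ge0 => a' _; rewrite mulr_ge0 ?desirability_ge0//;
   case: (pa_distr M x' x a).
Qed.

Lemma running_cost_gtNy x a : (-oo < q M x a)%E.
Proof.
have [/(q_terminal (s := M))/andP[q0 _]|T] := boolP ((x, a) \in terminal M).
  exact: lt_le_trans q0.
have [/(q_obstacle (s := M))->//|/(q_step T)->] := boolP ((x, a) \in obstacle M).
by rewrite ltNyr.
Qed.

Lemma running_cost_ge0 x a : (0 <= q M x a)%E.
Proof.
have [/(q_terminal (s := M))/andP[]//|T] := boolP ((x, a) \in terminal M).
have [/(q_obstacle (s := M))->//|/(q_step T)->] := boolP ((x, a) \in obstacle M).
by rewrite lee_fin ltW// step_cost_gt0.
Qed.

(** Conditioning on [x'] lets the action distributions be optimized separately for each [x']. *)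
Lemma bellman_costE u x a : is_policy u ->
  bellman_cost M v u x a = (q M x a + \sum_x' (px M x a x')%:E *
    \sum_a' (u x' x a a')%:E *
      (log_ratio (u x' x a a') (pa M x' x a a') + v x' a'))%E.
Proof.
move=> uP; rewrite /bellman_cost /expect; congr (_ + _)%E.
(* Moving [px] inside the inner sum is legitimate because no term is [-oo]. *)
under [RHS]eq_bigr => x' _.
  rewrite fin_num_sume_distrr//; last first.
    move=> a1 a2 _ _; have [u0 _] := uP x' x a; have [p0 _] := pa_distr M x' x a.
    by apply: ltninfty_adde_def; rewrite inE; apply: divergence_term_gtNy.
  over.
rewrite pair_bigA /=; apply: eq_bigr => -[x' a'] _ /=.
by rewrite /joint EFinM muleA.
Qed.

Lemma bellman_cost_ge u x a : is_policy u ->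
  (q M x a + \sum_x' (px M x a x')%:E * - lne (normalizer M z x' x a)%:E <=
   bellman_cost M v u x a)%E.
Proof.
move=> uP; rewrite bellman_costE// leeD2l//; apply: lee_sum => x' _.
have [p0 _] := px_distr M x a.
apply: lee_wpmul2l; rewrite ?lee_fin//.
by apply: divergence_ge; [exact: uP|exact: pa_distr|exact: v_gtNy].
Qed.

(** The formula leaves [u] free where [px] or the normalizer vanishes: the former has weight 0, and
    in the latter the inner sum is [+oo] for every policy. *)
Lemma bellman_cost_optimal u x a : is_policy u -> is_optimal_form M z u x a ->
  bellman_cost M v u x a =
  (q M x a + \sum_x' (px M x a x')%:E * - lne (normalizer M z x' x a)%:E)%E.
Proof.
move=> uP uO; rewrite bellman_costE//; congr (_ + _)%E; apply: eq_bigr => x' _.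
have [p0 _] := px_distr M x a.
have := p0 x'; rewrite le_eqVlt => /predU1P[<-|px0]; first by rewrite !mul0e.
congr (_ * _)%E; apply: divergence_eq; [exact: uP|exact: pa_distr|exact: v_gtNy|].
by move=> N0 a'; exact: uO.
Qed.

Lemma optimal_policy_exists :
  exists u, is_policy u /\ forall x a, is_optimal_form M z u x a.
Proof.
(* Where the normalizer is 0 the formula gives no distribution, so the passive kernel fills in. *)
exists (fun x' x a => if 0 < normalizer M z x' x a
  then fun a' => pa M x' x a a' * z x' a' / normalizer M z x' x a
  else pa M x' x a).
split=> [x' x a|x a x' _ -> //].
case: ifPn => [N0|_]; last exact: pa_distr.
split=> [a'|]; last by rewrite -mulr_suml divff// gt_eqF.
have [p0 _] := pa_distr M x' x a.
by rewrite divr_ge0 ?mulr_ge0 ?desirability_ge0 ?normalizer_ge0.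
Qed.

(** Applied to [f = z] for the linear equation and to [f = 1] for the row sums. *)
Lemma Pmx_vec_of (f : X -> A -> R) i :
  (Pmx M *m vec_of f) i 0 =
  if enum_val i \in terminal M then f (enum_val i).1 (enum_val i).2
  else \sum_x' px M (enum_val i).1 (enum_val i).2 x' *
         normalizer M f x' (enum_val i).1 (enum_val i).2.
Proof.
rewrite mxE; case: ifPn => T.
  rewrite (bigD1 i)//= !mxE T eqxx mul1r big1 ?addr0// => j ji.
  by rewrite !mxE T eq_sym (negbTE ji) mul0r.
under eq_bigr => j _ do rewrite !mxE (negbTE T).
set x := (enum_val i).1; set a := (enum_val i).2.
transitivity (\sum_s joint M (pa M) x a s * f s.1 s.2).
  by rewrite [RHS](reindex _ (onW_bij _ (@enum_val_bij _))).
under [RHS]eq_bigr => x' _ do rewrite mulr_sumr.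
rewrite pair_bigA /=; apply: eq_bigr => -[x' a'] _ /=.
by rewrite /joint mulrA.
Qed.

Lemma Pmx_ge0 i j : 0 <= Pmx M i j.
Proof.
rewrite mxE; case: ifP => _; first exact: ler0n.
have [p0 _] := px_distr M (enum_val i).1 (enum_val i).2.
by rewrite mulr_ge0//; have [] := pa_distr M (enum_val j).1 (enum_val i).1 (enum_val i).2.
Qed.

Lemma Pmx_row_sum i : \sum_j Pmx M i j = 1.
Proof.
have := Pmx_vec_of (fun _ _ => 1) i; rewrite mxE.
under eq_bigr => j _ do rewrite [vec_of _ _ _]mxE /= mulr1.
move=> ->; case: ifP => // _.
rewrite -[RHS](px_distr M (enum_val i).1 (enum_val i).2).2.
apply: eq_bigr => x' _; rewrite /normalizer.
under eq_bigr do rewrite mulr1.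
by have [_ ->] := pa_distr M x' (enum_val i).1 (enum_val i).2; rewrite mulr1.
Qed.

End LMDP.

(** * The equation for [z] and its eigenvector form *)

Theorem mainTheorem1 (R : realType) (X A : finType) (M : saLMDP R X A)
    (v : X -> A -> \bar R) (hv : first_exit_bellman M v) :
  let z := desirability v in
  (* (1) *)
  ((exists u, is_policy u /\
      forall x a, (x, a) \notin terminal M -> is_optimal_form M z u x a) /\
   (forall u x a, is_policy u -> (x, a) \notin terminal M ->
      is_optimal_form M z u x a -> attains_min M v u x a)) /\
  (* (2) *)
  (forall x a, (x, a) \notin terminal M ->
     (z x a)%:E =
     (expeR (- q M x a) *
      expeR (expect (px M x a) (fun x' => lne (normalizer M z x' x a)%:E)))%E) /\
  (* (3) *)
  (deterministic M ->
     (forall x a, (x, a) \notin terminal M ->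
        z x a = exp_opp (q M x a) *
                \sum_(x' : X) px M x a x' * normalizer M z x' x a) /\
     ((forall x a, (x, a) \in terminal M -> q M x a = 0%E) ->
        vec_of z = Qmx M *m Pmx M *m vec_of z /\
        (terminal M != finset.set0 ->
         principal_eigenvector (Qmx M *m Pmx M) 1 (vec_of z)))).
Proof.
move=> z; have [v_gtNy vT vB] := hv.
have [u [uP uO]] := optimal_policy_exists M v.
have vE x a : (x, a) \notin terminal M -> v x a =
    (q M x a + \sum_x' (px M x a x')%:E * - lne (normalizer M z x' x a)%:E)%E.
  (* The infimum is at most the cost of the optimal policy [u], and the Gibbs bound holds for every
     policy. *)
  move=> T; apply/eqP; rewrite eq_le; apply/andP; split.
    rewrite -(bellman_cost_optimal v_gtNy uP (uO x a)) vB//.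
    by apply: ereal_inf_lbound; exists u.
  rewrite vB//; apply/ereal_infP => _ [w wP <-].
  exact: bellman_cost_ge.
have zE x a : (x, a) \notin terminal M -> (z x a)%:E = (expeR (- q M x a) *
    expeR (expect (px M x a) (fun x' => lne (normalizer M z x' x a)%:E)))%E.
  move=> T; have [p0 _] := px_distr M x a.
  (* [log N] may be [-oo] but never [+oo]; this allows the sign to be pulled out of the sum and out
     of [q - E log N]. *)
  have lt_y x' : ((px M x a x')%:E * lne (normalizer M z x' x a)%:E < +oo)%E.
    have : (-oo < - lne (normalizer M z x' x a)%:E)%E.
      have [N0|N0] := ltP 0 (normalizer M z x' x a).
        by rewrite lne_EFin// -EFinN ltNyr.
      by rewrite [lne _]le0_lneNy// lee_fin.
    by move=> /(mule_EFin_gtNy (p0 x')); rewrite muleN lteNr.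
  rewrite /z /desirability exp_oppE// vE// -expeRD; congr expeR.
  under eq_bigr do rewrite muleN.
  rewrite sumeN; last by move=> i j _ _; apply: ltpinfty_adde_def; rewrite inE.
  rewrite oppeB//; apply: ltninfty_adde_def; rewrite inE ?running_cost_gtNy//.
  by rewrite lteNr; exact: lte_sum_pinfty.
split; [split|split=> // det].
- by exists u; split.
- move=> w x a wP T wO; rewrite /attains_min (bellman_cost_optimal v_gtNy wP wO).
  by split; [exact: vE|move=> w' w'P; exact: bellman_cost_ge].
have z3 x a : (x, a) \notin terminal M -> z x a = exp_opp (q M x a) *
    \sum_(x' : X) px M x a x' * normalizer M z x' x a.
  move=> T; apply: EFin_inj; rewrite zE// EFinM exp_oppE ?running_cost_gtNy//.
  have [y [py _]] := det x a.
  rewrite (expect_eq1 (px_distr M x a) py) (sum_eq1 (px_distr M x a) py).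
  (* [exp (log N) = N] holds also at [N = 0], where [log N = -oo]. *)
  by congr (_ * _)%E; apply/eqP; rewrite lneK_eq lee_fin normalizer_ge0.
split=> // q0.
have zQP : vec_of z = Qmx M *m Pmx M *m vec_of z.
  apply/matrixP => i j; rewrite ord1 -mulmxA mul_diag_mx [RHS]mxE Pmx_vec_of !mxE.
  case: ifPn => T; last by rewrite z3 -?surjective_pairing.
  (* On a terminal row [Pmx] is the identity, and [q = 0] makes the entry of [Qmx] equal to 1. *)
  by rewrite q0 -?surjective_pairing// /exp_opp /= oppr0 expR0 mul1r.
split=> // T0; split.
(* [z = 1] at every terminal state-action, so one such entry shows that the vector is nonzero. *)
- case/set0Pn : T0 => s sT; apply/eqP => /matrixP/(_ (enum_rank s) 0).
  rewrite !mxE enum_rankK /z /desirability vT -?surjective_pairing//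
    q0 -?surjective_pairing//.
  by rewrite /exp_opp /= oppr0 expR0; apply/eqP; rewrite oner_eq0.
- by rewrite -zQP scale1r.
(* The row of [Qmx M *m Pmx M] at [(x, a)] sums to [exp (- q x a) <= 1], so the substochastic bound
   applies over the complex numbers. *)
move=> mu; rewrite normr1 => /substochastic_eigenvalue_norm; apply.
- move=> i j; rewrite mxE ler0c mul_diag_mx mxE mxE.
  by rewrite mulr_ge0 ?exp_opp_ge0// Pmx_ge0.
- move=> i; under eq_bigr do rewrite mxE.
  rewrite -rmorph_sum -(rmorph1 (real_complex R)) lecR.
  under eq_bigr do rewrite mul_diag_mx mxE.
  rewrite -mulr_sumr Pmx_row_sum mulr1 mxE exp_opp_le1//; exact: running_cost_ge0.
Qed.
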